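(* Let $G$ be a finite simple graph with arc set $\mathcal{A}$ and subdivision graph $S(G)$. Let $U_{BW}(S(G))$ be the transition matrix of the bipartite walk defined on $S(G)$ (with color classes $C_0=V(S(G))\setminus V(G)$ and $C_1=V(G)$), and let $U_{GW}(G)$ be the transition matrix of Grover's walk defined on $G$. Identify each arc $\alpha=(x,y)\in\mathcal{A}$ with the edge of $S(G)$ joining $t(\alpha)=y\in V(G)$ to the vertex of $S(G)$ that subdivides the edge $\{x,y\}$ of $G$. Under this identification of the index sets $\mathcal{A}$ and $E(S(G))$, $$U_{BW}(S(G))=U_{GW}(G).$$
   Context: Grover's walk: the arc set of $G$ is $\mathcal{A}=\{(a,b),(b,a)\mid\{a,b\}\in E(G)\}$. For an arc $\alpha=(x,y)$ put $t(\alpha)=y$ and $\alpha^{-1}=(y,x)$. Let $D\in\mathbb{C}^{V(G)\times\mathcal{A}}$ have entries $D_{x,\alpha}=\frac{1}{\sqrt{\deg(x)}}$ if $x=t(\alpha)$ and $0$ otherwise, and let $R\in\mathbb{C}^{\mathcal{A}\times\mathcal{A}}$ be the arc-reversal matrix, $R_{\alpha,\beta}=1$ if $\alpha=\beta^{-1}$ and $0$ otherwise. The transition matrix of Grover's walk on $G$ is $R(2D^*D-I)$. The subdivision graph $S(G)$ is obtained from $G$ by subdividing every edge exactly once. Bipartite walk: for a bipartite graph $H$ with color classes $C_0,C_1$, let $\pi_0$ (resp. $\pi_1$) be the partition of $E(H)$ in which two edges are in the same cell if and only if they have the same end in $C_0$ (resp. $C_1$). Let $P$ (resp. $Q$) be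 the orthogonal projection of $\mathbb{C}^{E(H)}$ onto the vectors that are constant on the cells of $\pi_0$ (resp. $\pi_1$). The transition matrix of the bipartite walk over $H$ is $U=(2P-I)(2Q-I)$. *)

(* Defs.v *)
From HB Require Import structures.
From mathcomp Require Import all_boot all_order all_algebra.
From mathcomp Require Import sesquilinear spectral.

Set Implicit Arguments.
Unset Strict Implicit.
Unset Printing Implicit Defensive.

Import Order.TTheory GRing.Theory Num.Theory.
Local Open Scope ring_scope.
Local Open Scope sesquilinear_scope.

Record sgraph := SGraph {
  vertex :> finType;
  adj : rel vertex;
  adj_sym : symmetric adj;
  adj_irrefl : irreflexive adj }.

Definition deg (G : sgraph) (x : G) : nat := #|[set y | adj x y]|.

Definition edge_set (G : sgraph) : {set {set G}} :=
  [set [set x; y] | x in G, y in G & adj x y].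

Definition edge (G : sgraph) : finType := {A : {set G} | A \in edge_set G}.

Definition arc (G : sgraph) : finType := {a : G * G | adj a.1 a.2}.

Definition terminus (G : sgraph) (a : arc G) : G := (val a).2.

Lemma arc_inv_subproof (G : sgraph) (a : arc G) : adj (val a).2 (val a).1.
Proof. by rewrite adj_sym; exact: (valP a). Qed.

Definition arc_inv (G : sgraph) (a : arc G) : arc G :=
  Sub ((val a).2, (val a).1) (arc_inv_subproof a).

(* Matrices with entries in C whose rows and columns are indexed by finite
   types I and J, encoded through the enumerations of I and J. *)
Definition fmx (C : Type) (I J : finType) (f : I -> J -> C) :
    'M[C]_(#|I|, #|J|) :=
  \matrix_(i, j) f (enum_val i) (enum_val j).

Section Grover.
Variables (C : numClosedFieldType) (G : sgraph).

Definition grover_D : 'M[C]_(#|G|, #|arc G|) :=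
  fmx (fun (x : G) (a : arc G) =>
    if x == terminus a then 1 / sqrtC (deg x)%:R else 0).

Definition grover_R : 'M[C]_#|arc G| :=
  fmx (fun a b : arc G => (a == arc_inv b)%:R).

Definition grover_walk : 'M[C]_#|arc G| :=
  grover_R *m (2 *: (grover_D^t* *m grover_D) - 1%:M).

End Grover.

Definition bipartition (H : sgraph) (C0 C1 : {set H}) : Prop :=
  [/\ C0 :|: C1 = [set: H], [disjoint C0 & C1] &
      forall x y : H, adj x y ->
        (x \in C0) && (y \in C1) || (x \in C1) && (y \in C0)].

(* If (C0, C1) is a bipartition of H, then e :&: C0 is the singleton containing
   the end of the edge e in C0 (see bipartition_end). *)
Definition end_partition (H : sgraph) (K : {set H}) : {set {set edge H}} :=
  preim_partition (fun e : edge H => val e :&: K) [set: edge H].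

Lemma bipartition_end (H : sgraph) (C0 C1 : {set H}) (e : edge H) :
  bipartition C0 C1 ->
  exists x y : H, [/\ adj x y, val e = [set x; y],
    val e :&: C0 = [set x] & val e :&: C1 = [set y]].
Proof.
case=> _ dis bip.
have not01 z : z \in C0 -> z \in C1 = false.
  by move=> z0; apply: contraTF dis => z1; apply/pred0Pn; exists z; apply/andP.
have main x y : adj x y -> x \in C0 -> y \in C1 ->
    [set x; y] :&: C0 = [set x] /\ [set x; y] :&: C1 = [set y].
  move=> xy x0 y1; split; apply/setP=> z; rewrite !inE.
    have [->|_] := eqVneq z x; first by rewrite x0.
    have [->|//] := eqVneq z y.
    by apply/negP=> /not01; rewrite y1.
  have [->|_] /= := eqVneq z x.
    by rewrite (not01 _ x0); apply/esym/eqP=> exy; move: y1; rewrite -exy not01.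
  by have [->|//] := eqVneq z y.
have /imset2P[x y _] := valP e; rewrite inE => xy Ee.
have /orP[/andP[x0 y1]|/andP[x1 y0]] := bip x y xy.
  by have [e0 e1] := main x y xy x0 y1; exists x, y; rewrite Ee.
have yx : adj y x by rewrite adj_sym.
by have [e0 e1] := main y x yx y0 x1; exists y, x; rewrite Ee setUC.
Qed.

Section BipartiteWalk.
Variables (C : numClosedFieldType).

(* The subspace of the vectors that are constant on the cells of pi, as a row
   space: v *m (delta_mx s 0 - delta_mx t 0) = 0 says that the entries of the
   row vector v at s and t agree (see cell_constP). *)
Definition cell_const (T : finType) (pi : {set {set T}}) : 'M[C]_#|T| :=
  (\bigcap_(B in pi) \bigcap_(s in B) \bigcap_(t in B)
     kermx (delta_mx (enum_rank s) 0 - delta_mx (enum_rank t) 0 : 'cV[C]_#|T|)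
  )%MS.

Lemma cell_constP (T : finType) (pi : {set {set T}}) (v : 'rV[C]_#|T|) :
  reflect (forall B, B \in pi -> forall s t, s \in B -> t \in B ->
             v 0 (enum_rank s) = v 0 (enum_rank t))
          (v <= cell_const pi)%MS.
Proof.
have kerE s t : (v <= kermx (delta_mx (enum_rank s) 0
    - delta_mx (enum_rank t) 0 : 'cV[C]_#|T|))%MS =
    (v 0 (enum_rank s) == v 0 (enum_rank t)).
  rewrite (sameP sub_kermxP eqP) mulmxBr subr_eq0 -!colE.
  apply/eqP/eqP => [/matrixP/(_ 0 0)|h]; first by rewrite !mxE.
  by apply/matrixP=> i j; rewrite !mxE !ord1.
apply: (iffP sub_bigcapmxP) => [h B piB s t sB tB|h B piB].
  apply/eqP; rewrite -kerE.
  by move/sub_bigcapmxP: (h B piB) => /(_ s sB)/sub_bigcapmxP/(_ t tB).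
apply/sub_bigcapmxP=> s sB; apply/sub_bigcapmxP=> t tB.
by rewrite kerE; apply/eqP; exact: (h B).
Qed.

(* The library's proj_ortho acts on row vectors from the right; its transpose is
   the matrix acting on column vectors from the left. *)
Definition cell_proj (T : finType) (pi : {set {set T}}) : 'M[C]_#|T| :=
  (proj_ortho (cell_const pi))^T.

Definition bipartite_walk (H : sgraph) (C0 C1 : {set H}) : 'M[C]_#|edge H| :=
  let P := cell_proj (end_partition C0) in
  let Q := cell_proj (end_partition C1) in
  (2 *: P - 1%:M) *m (2 *: Q - 1%:M).

End BipartiteWalk.

Section Subdivision.
Variable G : sgraph.

(* inl x is the original vertex x; inr e is the vertex subdividing the edge e. *)
Definition subdiv_adj : rel (G + edge G) := fun u v =>
  match u, v with
  | inl x, inr e | inr e, inl x => x \in val e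
  | _, _ => false
  end.

Lemma subdiv_adj_sym : symmetric subdiv_adj.
Proof. by case=> [x|e] [y|f]. Qed.

Lemma subdiv_adj_irrefl : irreflexive subdiv_adj.
Proof. by case. Qed.

Definition subdivision : sgraph := SGraph subdiv_adj_sym subdiv_adj_irrefl.

Definition old_vertices : {set subdivision} := [set inl x | x : G].

Definition new_vertices : {set subdivision} := ~: old_vertices.

Lemma mem_old_vertices (u : subdivision) :
  (u \in old_vertices) = if u is inl _ then true else false.
Proof.
case: u => [x|e]; first by apply/imsetP; exists x.
by apply/imsetP=> -[].
Qed.

Lemma subdivision_bipartition : bipartition new_vertices old_vertices.
Proof.
split; first by rewrite setUC setUCr.
  by rewrite disjoint_sym -subsets_disjoint.
by move=> [x|e] [y|f] //=; rewrite !inE !mem_old_vertices.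
Qed.

Lemma arc_support_subproof (a : arc G) :
  [set (val a).1; (val a).2] \in edge_set G.
Proof. by apply/imset2P; exists (val a).1 (val a).2; rewrite ?inE ?(valP a). Qed.

Definition arc_support (a : arc G) : edge G :=
  Sub [set (val a).1; (val a).2] (arc_support_subproof a).

Lemma arc_edge_subproof (a : arc G) :
  [set inl (terminus a); inr (arc_support a)] \in edge_set subdivision.
Proof.
apply/imset2P; exists (inl (terminus a)) (inr (arc_support a)) => //.
by rewrite inE /= !inE eqxx orbT.
Qed.

Definition arc_edge (a : arc G) : edge subdivision :=
  Sub ([set inl (terminus a); inr (arc_support a)] : {set subdivision})
      (arc_edge_subproof a).

Lemma arc_edge_bij : bijective arc_edge.
Proof.
have inj : injective arc_edge.
  move=> a b /(congr1 val) /= /setP E.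
  have ta : terminus a = terminus b.
    by move: (E (inl (terminus a))); rewrite !inE eqxx /= orbF => /esym/eqP[].
  have sa : arc_support a = arc_support b.
    move: (E (inr (arc_support a))); rewrite !inE eqxx orbT => /esym/orP[]/eqP h; first by [].
    by apply: (congr1 (fun u => if u is inr f then f else arc_support a) h).
  move: a b ta {E} sa => [[a1 a2] /= ha] [[b1 b2] /= hb].
  rewrite /terminus /= => e2; subst b2.
  move=> /(congr1 val) /= /setP/(_ a1); rewrite !inE eqxx /= => /esym/orP[]/eqP e1.
    by apply/val_inj; rewrite /= e1.
  by have /negP[] : ~~ adj a1 a2 by rewrite e1 adj_irrefl.
have surj (f : edge subdivision) : exists a, arc_edge a = f.
  suff H (x : G) (e : edge G) : x \in val e ->
      exists a, val (arc_edge a) = [set inl x; inr e].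
    have /imset2P[u v _] := valP f; rewrite inE.
    case: u v => [x|e] [y|e'] //= xe Ef.
      have [a Ea] := H x e' xe; exists a; apply/val_inj.
      by rewrite Ea; exact: esym Ef.
    have [a Ea] := H y e xe; exists a; apply/val_inj.
    by rewrite Ea setUC; exact: esym Ef.
  have /imset2P[y z _] := valP e; rewrite inE => yz Ee.
  rewrite Ee !inE => /orP[]/eqP->.
    have zy : adj (z, y).1 (z, y).2 by rewrite adj_sym.
    exists (Sub (z, y) zy) => /=; congr [set _; inr _].
    by apply/val_inj; rewrite /= Ee setUC.
  exists (Sub (y, z) (yz : adj (y, z).1 (y, z).2)) => /=; congr [set _; inr _].
  by apply/val_inj; rewrite /= Ee.
have card : #|edge subdivision| = #|arc G|.
  apply/eqP; rewrite -(card_codom inj) eq_sym; apply/eqP/eq_card => f.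
  by have [a <-] := surj f; rewrite inE codom_f.
by apply: inj_card_bij => //; rewrite card.
Qed.

(* arc_edge on the indices of rows and columns. *)
Definition arc_edge_idx (i : 'I_#|arc G|) : 'I_#|edge subdivision| :=
  enum_rank (arc_edge (enum_val i)).

End Subdivision.

(* Main.v *)
Require Import Defs.
From mathcomp Require Import all_boot all_order all_algebra.
From mathcomp Require Import sesquilinear spectral.

(** For a map [f] on a finite set, the projection onto the vectors constant on
    the fibres of [f] averages over each fibre.  Under the identification of arcs
    with edges of the subdivision graph, the fibres of [C0] are the pairs
    [{a, a^-1}], so [2P - I] is the arc reversal, while the fibres of [C1] are the
    sets of arcs with a common terminus, so [Q] is [D^* D]. *)

Set Implicit Arguments.
Unset Strict Implicit.
Unset Printing Implicit Defensive.

Import Order.TTheory GRing.Theory Num.Theory.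
Local Open Scope ring_scope.
Local Open Scope sesquilinear_scope.

Section FibreProjection.
Variable C : numClosedFieldType.

(** Write [1%:M] as [(1%:M - M) + M]: the orthogonal projection kills the first summand, whose rows
    are orthogonal to [U], and fixes the second, whose rows lie in [U]. *)
Lemma proj_ortho_unique p n (U : 'M[C]_(p, n)) (M : 'M_n) :
  (M <= U)%MS -> (1%:M - M) *m U^t* = 0 -> proj_ortho U = M.
Proof.
move=> MU /eqP MUo.
rewrite -[LHS]mul1mx -[1%:M](subrK M) mulmxDl (proj_ortho_id MU).
by rewrite proj_ortho_0 ?add0r // orthomx1E.
Qed.

Variables (T : finType) (rT : eqType) (f : T -> rT).

Definition fibre (s : T) : {set T} := [set u | f u == f s].

Definition fibre_mean : 'M[C]_#|T| :=
  fmx (fun s t => (f s == f t)%:R / #|fibre s|%:R).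

Lemma fibre_eq s t : f s = f t -> fibre s = fibre t.
Proof. by rewrite /fibre => ->. Qed.

Lemma card_fibre_neq0 s : #|fibre s|%:R != 0 :> C.
Proof. by rewrite pnatr_eq0 -lt0n; apply/card_gt0P; exists s; rewrite inE. Qed.

(** An entry is nonzero only if [s] and [t] share a fibre, and then both orders divide by the same
    cardinality. The symmetry absorbs the transpose in [cell_proj]. *)
Lemma trmx_fibre_mean : fibre_mean^T = fibre_mean.
Proof.
apply/matrixP=> i j; rewrite !mxE eq_sym.
by have [/fibre_eq->|] := eqVneq; rewrite // !mul0r.
Qed.

Lemma preim_partition_same s t B :
  B \in preim_partition f [set: T] -> s \in B -> t \in B -> f s = f t.
Proof.
by case/imsetP=> x _ ->; rewrite !inE /= => /eqP<- /eqP<-.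
Qed.

Lemma preim_partition_const (v : 'rV[C]_#|T|) :
  reflect (forall s t, f s = f t -> v 0 (enum_rank s) = v 0 (enum_rank t))
          (v <= cell_const C (preim_partition f [set: T]))%MS.
Proof.
apply: (iffP (cell_constP _ _)) => [h s t fst|h B piB s t sB tB]; last first.
  by apply: h; apply: preim_partition_same piB sB tB.
apply: (h [set u in [set: T] | f s == f u]); first exact: imset_f.
  by rewrite !inE eqxx.
by rewrite !inE fst eqxx.
Qed.

Lemma sum_fibre_mean (g : T -> C) s : (forall t, f s = f t -> g t = g s) ->
  \sum_t (f s == f t)%:R / #|fibre s|%:R * g t = g s.
Proof.
move=> g_const.
rewrite (eq_bigr (fun t => if t \in fibre s then g s / #|fibre s|%:R else 0)).
  by rewrite -big_mkcond sumr_const -[LHS]mulr_natr divfK ?card_fibre_neq0.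
move=> t _; rewrite inE eq_sym; case: eqP => [/esym/g_const->|_].
  by rewrite mul1r mulrC.
by rewrite !mul0r.
Qed.

Lemma cell_proj_fibre_mean :
  cell_proj C (preim_partition f [set: T]) = fibre_mean.
Proof.
rewrite /cell_proj -trmx_fibre_mean; congr _^T; apply: proj_ortho_unique.
  apply/row_subP=> i; apply/preim_partition_const=> s t fst.
  by rewrite !mxE !enum_rankK fst.
(* Orthogonality becomes the statement that [fibre_mean] fixes each column of the adjoint of [U].
   Such a column is a conjugated row of [U], hence constant on the fibres, and averaging leaves it
   unchanged. *)
set U := cell_const _ _; apply/eqP; rewrite mulmxBl mul1mx subr_eq0 eq_sym.
apply/eqP/matrixP=> i k; rewrite !mxE.
rewrite (reindex_onto enum_rank enum_val) /=; last first.
  by move=> j _; rewrite enum_valK.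
rewrite (eq_bigl xpredT) => [|t]; last by rewrite enum_rankK eqxx.
rewrite -[i in RHS]enum_valK.
rewrite -(@sum_fibre_mean (fun t => (U k (enum_rank t))^*)) => [|t fst].
  by apply: eq_bigr => t _; rewrite !mxE enum_rankK.
have /preim_partition_const/(_ _ _ fst) := row_sub k U.
by rewrite !mxE => ->.
Qed.

End FibreProjection.

Lemma mxsub_mulmx (R : pzSemiRingType) m n p m' n' p' (A : 'M[R]_(m, n))
    (B : 'M_(n, p)) (f : 'I_m' -> 'I_m) (g : 'I_n' -> 'I_n)
    (h : 'I_p' -> 'I_p) :
  bijective g -> mxsub f h (A *m B) = mxsub f g A *m mxsub g h B.
Proof.
move=> g_bij; apply/matrixP=> i k; rewrite !mxE (reindex g); last exact: onW_bij.
by apply: eq_bigr => j _; rewrite !mxE.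
Qed.

Section SubdividedWalk.
Variables (C : numClosedFieldType) (G : sgraph).
Implicit Types a b : Defs.arc G.

Lemma arc_edge_idx_bij : bijective (@arc_edge_idx G).
Proof.
exact: bij_comp (@enum_rank_bij _) (bij_comp (@arc_edge_bij G) (@enum_val_bij _)).
Qed.

(** The hypothesis makes [h] cut the arcs into the cells that the ends in [K] cut out on the edges;
    corresponding cells have equal size because [arc_edge] is bijective. *)
Lemma mxsub_end_proj (K : {set subdivision G}) (rT : eqType) (h : Defs.arc G -> rT) :
  (forall a b,
    (val (arc_edge a) :&: K == val (arc_edge b) :&: K) = (h a == h b)) ->
  mxsub (@arc_edge_idx G) (@arc_edge_idx G) (cell_proj C (end_partition K))
  = fibre_mean C h.
Proof.
move=> endE; rewrite /end_partition cell_proj_fibre_mean.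
apply/matrixP=> i j; rewrite !mxE !enum_rankK endE; congr (_ / _%:R).
rewrite -(on_card_preimset (onW_bij _ (arc_edge_bij G))).
by apply: eq_card => a; rewrite !inE endE.
Qed.

Lemma arc_edge_new a :
  val (arc_edge a) :&: new_vertices G = [set inr (arc_support a)].
Proof.
by apply/setP=> -[x|e]; rewrite !inE mem_old_vertices /= ?andbF ?andbT.
Qed.

Lemma arc_edge_old a :
  val (arc_edge a) :&: old_vertices G = [set inl (terminus a)].
Proof.
by apply/setP=> -[x|e]; rewrite !inE mem_old_vertices /= ?andbF ?andbT ?orbF.
Qed.

Lemma arc_inv_neq a : arc_inv a != a.
Proof.
case: a => -[x y] /= xy; apply/eqP=> /(congr1 val)[yx _].
by move: xy; rewrite /= yx adj_irrefl.
Qed.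

Lemma arc_support_eq a b :
  (arc_support a == arc_support b) = (a == b) || (a == arc_inv b).
Proof.
apply/eqP/orP=> [/(congr1 val)/=|[/eqP->//|/eqP->]]; last first.
  by apply/val_inj; rewrite /= setUC.
case: a b => -[x y] /= xy [[z w] /= zw] /setP E.
have := E x; have := E y; rewrite !inE !eqxx orbT -!(inj_eq val_inj) /= !xpair_eqE.
have /negbTE yx : y != x by apply: contraTneq xy => ->; rewrite adj_irrefl.
(* Both [x] and [y] lie in the pair of [z] and [w]. Of the four cases, the two that send them to the
   same end contradict [y != x]. *)
move=> /esym/orP[]/eqP yE /esym/orP[]/eqP xE.
- by rewrite yE xE eqxx in yx.
- by right; rewrite xE yE !eqxx.
- by left; rewrite xE yE !eqxx.
by rewrite yE xE eqxx in yx.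
Qed.

Lemma fibre_arc_support a : fibre (@arc_support G) a = [set a; arc_inv a].
Proof. by apply/setP=> b; rewrite !inE arc_support_eq. Qed.

(** An arc ending at [x] is determined by its origin, and the origins of such arcs are exactly the
    neighbours of [x]. *)
Lemma card_fibre_terminus a : #|fibre (@terminus G) a| = deg (terminus a).
Proof.
rewrite /deg; set x := terminus a.
rewrite -(card_in_imset (f := fun b => (val b).1)) => [|b c].
  apply: eq_card => y; apply/imsetP/idP => [[b]|].
    by rewrite !inE => /eqP bx ->; rewrite adj_sym /x -bx; exact: (valP b).
  rewrite inE adj_sym => yx.
  by exists (Sub (y, x) (yx : adj (y, x).1 (y, x).2)); rewrite ?inE.
rewrite !inE => /eqP bx /eqP cx bc.
apply/val_inj/eqP; rewrite -pair_eqE /pair_eq bc eqxx /=.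
by apply/eqP; rewrite -[LHS]/(terminus b) -[RHS]/(terminus c) bx cx.
Qed.

Lemma grover_RE : 2 *: fibre_mean C (@arc_support G) - 1%:M = grover_R C G.
Proof.
apply/matrixP=> i j; rewrite !mxE -(inj_eq enum_val_inj).
move: (enum_val i) (enum_val j) => a b.
rewrite fibre_arc_support cards2 [a == arc_inv a]eq_sym arc_inv_neq arc_support_eq.
(* The factor 2 cancels the fibre size, which is 2 because [arc_inv a != a]. Subtracting the
   identity then leaves only the entries with [a = arc_inv b]. *)
rewrite mulrC divfK ?pnatr_eq0 //.
have [->|_] := eqVneq a b; last by rewrite subr0.
by rewrite eq_sym (negbTE (arc_inv_neq b)) subrr.
Qed.

Lemma grover_DE :
  fibre_mean C (@terminus G) = (grover_D C G)^t* *m grover_D C G.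
Proof.
apply/matrixP=> i j; rewrite !mxE.
set a := enum_val i.
(* Column [a] of [grover_D] vanishes outside the row [terminus a], so one term of the sum
   survives. *)
rewrite (bigD1 (enum_rank (terminus a))) //= big1 => [|k ka].
  rewrite !mxE enum_rankK -/a eqxx addr0 card_fibre_terminus.
  case: eqP => _; last by rewrite mulr0 mul0r.
  (* The square root is a nonnegative real, so conjugation fixes it and the two factors multiply to
     the inverse degree. *)
  have dge0 : 0 <= sqrtC (deg (terminus a))%:R :> C by rewrite sqrtC_ge0 ler0n.
  rewrite !mul1r conj_Creal ?rpredV ?ger0_real //.
  by rewrite -[in LHS](sqrtCK _%:R) expr2 invfM.
rewrite !mxE ifN ?rmorph0 ?mul0r //.
by apply: contraNneq ka => <-; rewrite enum_valK.
Qed.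

End SubdividedWalk.

Theorem theorem5p1 (C : numClosedFieldType) (G : sgraph) :
  mxsub (@arc_edge_idx G) (@arc_edge_idx G)
    (@bipartite_walk C (subdivision G) (new_vertices G) (old_vertices G))
  = grover_walk C G.
Proof.
have idx_bij := arc_edge_idx_bij G.
(* Relabelling by an injective map sends the identity matrix to the identity matrix, so it commutes
   with forming the reflection. *)
have reflect_sub (P : 'M[C]_#|edge (subdivision G)|) :
    mxsub (@arc_edge_idx G) (@arc_edge_idx G) (2 *: P - 1%:M)
    = 2 *: mxsub (@arc_edge_idx G) (@arc_edge_idx G) P - 1%:M.
  by apply/matrixP=> i j; rewrite !mxE (inj_eq (bij_inj idx_bij)).
rewrite /bipartite_walk /grover_walk (mxsub_mulmx _ _ _ _ idx_bij) !reflect_sub.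
rewrite (@mxsub_end_proj C G _ _ (@arc_support G)); last first.
  by move=> a b; rewrite !arc_edge_new (inj_eq set1_inj) (inj_eq inr_inj).
rewrite (@mxsub_end_proj C G _ _ (@terminus G)); last first.
  by move=> a b; rewrite !arc_edge_old (inj_eq set1_inj) (inj_eq inl_inj).
by rewrite grover_RE grover_DE.
Qed.
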